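(* Let $\mathsf{G}$ be the category of unital Abelian $\ell$-groups and unital $\ell$-homomorphisms, and $\mathsf{K_a}$ the category of compact a-spaces and a-maps. The contravariant functors $\operatorname{Max}\colon\mathsf{G}\to\mathsf{K_a}$ and $\mathrm{C_a}\colon\mathsf{K_a}\to\mathsf{G}$ are adjoint, with units given, for $G\in\mathsf{G}$ and $X\in\mathsf{K_a}$, by the evaluations $$\eta_X\colon X\to\operatorname{Max}\mathrm{C_a}(X),\quad x\mapsto\operatorname{ev}_x,\qquad \varepsilon_G\colon G\to\mathrm{C_a}(\operatorname{Max}G),\quad g\mapsto\operatorname{ev}_g,$$ where $\operatorname{ev}_x\colon\mathrm{C_a}(X)\to\mathbb{R}$ is $\operatorname{ev}_x(a)=a(x)$ and $\operatorname{ev}_g\colon\operatorname{Max}G\to\mathbb{R}$ is $\operatorname{ev}_g(h)=h(g)$.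
   Context: **a-spaces.** $\mathbb{N}=\{0,1,2,\dots\}$ is ordered by divisibility ($0$ is the top element, $1$ the bottom); $\operatorname{lcm}$ of a possibly infinite subset of $\mathbb{N}$ is its supremum in this order (so it is $0$ if there is no positive common multiple). $\mathbb{N}$ carries the upper topology of the divisibility order: the sets $\{m\in\mathbb{N}\mid m \text{ divides } n\}$, $n\in\mathbb{N}$, form a subbasis for the closed sets. An a-space $(X,\zeta)$ is a topological space $X$ with a continuous function $\zeta\colon X\to\mathbb{N}$. An a-map $f\colon (X,\zeta)\to(X',\zeta')$ is a continuous map such that $\zeta'(f(x))$ divides $\zeta(x)$ for all $x\in X$. A compact a-space is an a-space whose underlying space is compact (Hausdorffness not assumed). For $p/q\in\mathbb{Q}$ with $p\in\mathbb{Z}$, $q\geq 1$ coprime, $\operatorname{den}(p/q)=q$; for irrational $r$, $\operatorname{den}(r)=0$; $\mathbb{R}$ with the Euclidean topology and $\operatorname{den}$ is an a-space. **$\ell$-groups.** A unital Abelian $\ell$-group is an Abelian lattice-ordered group $G$ with a distinguished element $1$ such that for each $g\in G$ there is a positive integer $p$ with $g\le p\cdot 1$; a unital $\ell$-homomorphism is a group and lattice homomorphism preserving $1$. **The functors.** For a compact a-space $X$, $\mathrm{C_a}(X)$ is the set of a-maps $X\to(\mathbb{R},\operatorname{den})$ with pointwise operations and unit the constant function $1$. For a unital Abelian $\ell$-group $G$, $\operatorname{Max}G$ is the set of unital $\ell$-homomorphisms $G\to\mathbb{R}$, with the topology generated by the sets $\{x\in\operatorname{Max}G\mid x(g)\in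 U\}$ ($g\in G$, $U\subseteq\mathbb{R}$ open) and denominator function $\zeta(x)=\operatorname{lcm}\{\operatorname{den}(x(g))\mid g\in G\}$. Both act on morphisms by pre-composition. Contravariant functors being adjoint with units $\eta,\varepsilon$ means that $\eta$ and $\varepsilon$ are natural transformations (with components morphisms of the respective categories) satisfying the triangle identities $\operatorname{Max}(\varepsilon_G)\circ\eta_{\operatorname{Max}G}=\mathrm{id}$ and $\mathrm{C_a}(\eta_X)\circ\varepsilon_{\mathrm{C_a}(X)}=\mathrm{id}$. *)

(* Defs.v *)
From HB Require Import structures.
From mathcomp Require Import all_boot all_order all_algebra.
From mathcomp Require Import all_classical all_reals all_analysis.
From mathcomp Require Import finmap zify.

Set Implicit Arguments.
Unset Strict Implicit.
Unset Printing Implicit Defensive.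

Import Order.TTheory GRing.Theory Num.Theory.
Import numFieldNormedType.Exports.

Local Open Scope classical_set_scope.
Local Open Scope ring_scope.

Record category := Category {
  obj :> Type;
  hom : obj -> obj -> Type;
  idm : forall A, hom A A;
  comp : forall A B C, hom B C -> hom A B -> hom A C;
  comp_idl : forall A B (f : hom A B), comp (idm B) f = f;
  comp_idr : forall A B (f : hom A B), comp f (idm A) = f;
  comp_assoc : forall A B C D (h : hom C D) (g : hom B C) (f : hom A B),
    comp h (comp g f) = comp (comp h g) f
}.

Record cofunctor (C D : category) := Cofunctor {
  fobj :> C -> D;
  fmap : forall A B, hom A B -> hom (fobj B) (fobj A);
  fmap_id : forall A, fmap (idm A) = idm (fobj A);
  fmap_comp : forall A B E (g : hom B E) (f : hom A B),
    fmap (comp g f) = comp (fmap f) (fmap g)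
}.
Arguments fmap {C D} _ {A B}.

Record contra_adjunction (C D : category) (F : cofunctor C D)
    (H : cofunctor D C) (eta : forall X : D, hom X (F (H X)))
    (eps : forall A : C, hom A (H (F A))) : Prop := ContraAdjunction {
  eta_natural : forall (X Y : D) (f : hom X Y),
    comp (fmap F (fmap H f)) (eta X) = comp (eta Y) f;
  eps_natural : forall (A B : C) (f : hom A B),
    comp (fmap H (fmap F f)) (eps A) = comp (eps B) f;
  triangle_eta : forall A : C, comp (fmap F (eps A)) (eta (F A)) = idm (F A);
  triangle_eps : forall X : D, comp (fmap H (eta X)) (eps (H X)) = idm (H X)
}.

(* [porderZmodType] carries a group and an order with no compatibility axiom.
   The lattice operations are fields here, rather than inherited from
   [latticeType], because Hierarchy Builder cannot insert a join of the additive
   and lattice structures below the already declared [realDomainType]. *)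
HB.mixin Record isLGroup G of Num.POrderedZmodule G := {
  lmeet : G -> G -> G;
  ljoin : G -> G -> G;
  le_lmeet : forall z x y : G, (z <= lmeet x y) = (z <= x) && (z <= y);
  ljoin_le : forall z x y : G, (ljoin x y <= z) = (x <= z) && (y <= z);
  lgroup_leD2l : forall z x y : G, x <= y -> z + x <= z + y
}.

#[short(type="lgroupType")]
HB.structure Definition LGroup := {G of isLGroup G & Num.POrderedZmodule G}.

HB.mixin Record isUnitalLGroup G of LGroup G := {
  lunit : G;
  lunit_strong : forall g : G, exists2 p : nat, (0 < p)%N & g <= lunit *+ p
}.

#[short(type="unitalLGroupType")]
HB.structure Definition UnitalLGroup := {G of isUnitalLGroup G & LGroup G}.

Record ulhom (G H : unitalLGroupType) := ULHom {
  ulhom_fun :> G -> H;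
  ulhomD : {morph ulhom_fun : x y / x + y};
  ulhomI : {morph ulhom_fun : x y / lmeet x y};
  ulhomU : {morph ulhom_fun : x y / ljoin x y};
  ulhom1 : ulhom_fun lunit = lunit
}.

Lemma ulhom_eq (G H : unitalLGroupType) (f g : ulhom G H) : f =1 g -> f = g.
Proof.
case: f g => [f fD fI fU f1] [g gD gI gU g1] /= /funext fg.
by rewrite -{}fg in gD gI gU g1 *; congr ULHom; exact: Prop_irrelevance.
Qed.

Definition ulhom_id (G : unitalLGroupType) : ulhom G G :=
  @ULHom G G idfun (fun _ _ => erefl) (fun _ _ => erefl) (fun _ _ => erefl)
    erefl.

Section ulhom_comp.
Variables (G H K : unitalLGroupType) (g : ulhom H K) (f : ulhom G H).

Fact ulhom_compD : {morph g \o f : x y / x + y}.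
Proof. by move=> x y /=; rewrite !ulhomD. Qed.

Fact ulhom_compI : {morph g \o f : x y / lmeet x y}.
Proof. by move=> x y /=; rewrite !ulhomI. Qed.

Fact ulhom_compU : {morph g \o f : x y / ljoin x y}.
Proof. by move=> x y /=; rewrite !ulhomU. Qed.

Fact ulhom_comp1 : (g \o f) lunit = lunit.
Proof. by rewrite /= !ulhom1. Qed.

Definition ulhom_comp : ulhom G K :=
  ULHom ulhom_compD ulhom_compI ulhom_compU ulhom_comp1.
End ulhom_comp.

Definition ulgroup_cat : category.
Proof.
refine (@Category unitalLGroupType ulhom ulhom_id ulhom_comp _ _ _);
  by move=> *; exact: ulhom_eq.
Defined.

HB.instance Definition _ := isSubBaseTopological.Build natdvd
  [set: nat] (fun n => ~` [set m : natdvd | (m %| n)%N]).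

(* [supremum] returns its default only on the empty set, whose lcm is 1. *)
Definition lcm_set (A : set natdvd) : natdvd := supremum (1%N : natdvd) A.

Lemma lcm_set_dvd (A : set natdvd) (n : nat) :
  (lcm_set A %| n)%N <-> forall a, A a -> (a %| n)%N.
Proof.
have [A0|A0] := pselect (A = set0).
  by rewrite /lcm_set A0 supremum0; split => // _; exact: dvd1n.
have [s [sub slub]] : supremums A !=set0.
  have [[m [m0 mA]]|noA] := pselect (exists m : nat,
      (0 < m)%N /\ forall a, A a -> (a %| m)%N); last first.
    exists 0%N; split => [a _|m mA]; first exact: dvdn0.
    rewrite /Order.le/=; have [->//|m0] := posnP m.
    by exfalso; apply: noA; exists m.
  pose P := [pred m : nat | `[< (0 < m)%N /\ forall a, A a -> (a %| m)%N >]].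
  have exP : exists m, P m by exists m; apply/asboolP.
  case: (ex_minnP exP) => k /asboolP[k0 kA] kmin.
  exists k; split => [a /kA //|l lA]; rewrite /Order.le/=.
  have : P (gcdn k l).
    apply/asboolP; split; first by rewrite gcdn_gt0 k0.
    by move=> a Aa; rewrite dvdn_gcd kA //=; exact: lA.
  move=> /kmin kg.
  have /eqP <- : gcdn k l == k.
    by rewrite eqn_leq kg andbT dvdn_leq// dvdn_gcdl.
  exact: dvdn_gcdr.
have -> : lcm_set A = s.
  rewrite /lcm_set /supremum ifF; last exact/eqP.
  case: xgetP => [x _ xs|/(_ s)]; last by case.
  exact: is_subset1_supremums xs (conj sub slub).
split => [sn a /sub as_|An]; last by apply: slub => a /An.
exact: dvdn_trans as_ sn.
Qed.

Lemma bigcap_fset_open (T : topologicalType) (I : choiceType) (E : {fset I})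
    (B : I -> set T) :
  (forall i, i \in E -> open (B i)) -> open (\bigcap_(i in [set` E]) B i).
Proof.
move=> EB; rewrite openE => x xB; rewrite /interior.
by apply: filter_bigI => i iE; apply: open_nbhs_nbhs; split; [exact: EB|exact: xB].
Qed.

Lemma natdvd_continuous (T : topologicalType) (f : T -> natdvd) :
  (forall n : nat, closed [set x | (f x %| n)%N]) -> continuous f.
Proof.
move=> fn; apply/continuousP => U [D DS <-].
rewrite preimage_bigcup; apply: bigcup_open => V /DS [E _ <-].
rewrite preimage_bigcap; apply: bigcap_fset_open => n _.
exact/closed_openC/fn.
Qed.

(* [denq q] is the denominator of the reduced fraction of [q], as a positive
   [int]; the set below is a singleton when [r] is rational. *)
Definition den (R : realType) (r : R) : natdvd :=
  if `[< rational r >] then `|denq (xget 0%Q [set q | ratr q = r])|%N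
  else 0%N.

Section den.
Variable R : realType.
Implicit Types (r s : R) (n : nat).

Lemma den_ratr (q : rat) : den (ratr q : R) = `|denq q|%N.
Proof.
rewrite /den asboolT; last by exists q.
case: xgetP => [p _ /= pq|/(_ q) /=]; last by move/(_ erefl).
by rewrite (fmorph_inj _ pq).
Qed.

Lemma den_irrational r : ~ rational r -> den r = 0%N.
Proof. by move=> rQ; rewrite /den asboolF. Qed.

Lemma den_dvd r n : (den r %| n)%N <-> n%:R * r \is a Num.int.
Proof.
have [[q _ <-]|rQ] := pselect (rational r); last first.
  rewrite den_irrational// dvd0n; split => [/eqP ->|/intrP[k nr]].
    by rewrite mul0r rpred0.
  apply: contrapT => /negP n0; apply: rQ; apply/rationalP; exists k, n.
  by rewrite -nr mulrC mulKf// pnatr_eq0.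
rewrite den_ratr -(ratr_nat R n) -rmorphM/=.
have -> : (`|denq q| %| n)%N = (n%:R * q \is a Num.int).
  rewrite -[in RHS](divq_num_den q) mulrA -[n%:R]/(n%:Z%:~R) -intrM.
  apply/idP/idP => [dn|].
    by apply: Qint_dvdz; rewrite dvdz_mulr.
  move=> /intrP[k]; move=> /(canRL (divfK _)); rewrite intr_eq0 denq_eq0.
  rewrite -intrM => /(_ isT) /intr_inj E.
  have : (denq q %| n%:Z * numq q)%Z by rewrite E dvdz_mull.
  rewrite dvdzE abszM Gauss_dvdl//.
  by rewrite coprime_sym; exact: coprime_num_den.
split => [/intrP[k ->]|/intrP[k]]; first by rewrite ratr_int; exact: intr_int.
by rewrite -ratr_int => /fmorph_inj ->; exact: intr_int.
Qed.

Lemma closed_int : closed [set r : R | r \is a Num.int].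
Proof.
rewrite -openC (_ : ~` _ = \bigcup_(k : int)
    [set` `](k%:~R : R), (k + 1)%:~R[]).
  by apply: bigcup_open => k _; exact: interval_open.
apply/seteqP; split => [r /= rZ|r [k _ /=]].
  exists (Num.floor r) => //=; rewrite in_itv/= floorD1_gt andbT lt_neqAle.
  rewrite floor_le_tmp andbT; apply: contra_notN rZ => /eqP <-.
  exact: intr_int.
rewrite in_itv/= => /andP[kr rk] /intrP[m rm]; move: kr rk.
by rewrite rm !ltr_int; lia.
Qed.

Lemma den_closed n : closed [set r : R | (den r %| n)%N].
Proof.
rewrite (_ : [set _ | _] = ( *%R n%:R) @^-1` [set r : R | r \is a Num.int]).
  by apply: preimage_closed closed_int => r _; exact: mulrl_continuous.
by apply/seteqP; split => r /=; rewrite den_dvd.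
Qed.

Lemma den_continuous : continuous (@den R).
Proof. exact/natdvd_continuous/den_closed. Qed.

Lemma den_add r s n : (den r %| n)%N -> (den s %| n)%N -> (den (r + s)%R %| n)%N.
Proof. by rewrite !den_dvd mulrDr; exact: rpredD. Qed.

Lemma den_opp r n : (den r %| n)%N -> (den (- r)%R %| n)%N.
Proof. by rewrite !den_dvd mulrN rpredN. Qed.

Lemma den_min r s n :
  (den r %| n)%N -> (den s %| n)%N -> (den (Num.min r s) %| n)%N.
Proof. by case: (leP r s). Qed.

Lemma den_max r s n :
  (den r %| n)%N -> (den s %| n)%N -> (den (Num.max r s) %| n)%N.
Proof. by case: (leP r s). Qed.

Lemma den_nat (m n : nat) : (den (m%:R : R) %| n)%N.
Proof. by rewrite den_dvd -natrM; exact: natr_int. Qed.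
End den.

HB.mixin Record isASpace X of Topological X := {
  zeta : X -> natdvd;
  zeta_continuous : continuous zeta
}.

#[short(type="aSpaceType")]
HB.structure Definition ASpace := {X of isASpace X & Topological X}.

HB.mixin Record isCompact X of Topological X := {
  compact_setT : compact [set: X]
}.

#[short(type="compactASpaceType")]
HB.structure Definition CompactASpace := {X of isCompact X & ASpace X}.

HB.instance Definition _ (R : realType) :=
  isASpace.Build R (@den_continuous R).

Record amap (X Y : aSpaceType) := AMap {
  amap_fun :> X -> Y;
  amap_continuous : continuous amap_fun;
  amap_zeta : forall x, (zeta (amap_fun x) %| zeta x)%N
}.

Lemma amap_eq (X Y : aSpaceType) (f g : amap X Y) : f =1 g -> f = g.
Proof.
case: f g => [f fc fz] [g gc gz] /= /funext fg.
by rewrite -{}fg in gc gz *; congr AMap; exact: Prop_irrelevance.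
Qed.

Definition amap_id (X : aSpaceType) : amap X X :=
  @AMap X X idfun (fun x => cvg_id) (fun x => dvdnn (zeta x)).

Section amap_comp.
Variables (X Y Z : aSpaceType) (g : amap Y Z) (f : amap X Y).

Fact amap_comp_continuous : continuous (g \o f).
Proof.
move=> x; apply: continuous_comp; exact: amap_continuous.
Qed.

Fact amap_comp_zeta x : (zeta ((g \o f) x) %| zeta x)%N.
Proof. exact: dvdn_trans (amap_zeta g (f x)) (amap_zeta f x). Qed.

Definition amap_comp : amap X Z := AMap amap_comp_continuous amap_comp_zeta.
End amap_comp.

Definition compact_aspace_cat : category.
Proof.
refine (@Category compactASpaceType amap amap_id amap_comp _ _ _);
  by move=> *; exact: amap_eq.
Defined.

Section real_lgroup.
Variable R : realType.

Fact real_leD2l (z x y : R) : x <= y -> z + x <= z + y.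
Proof. by rewrite lerD2l. Qed.

HB.instance Definition _ :=
  isLGroup.Build R (@le_min _ R) (@ge_max _ R) real_leD2l.

Fact real_strong_unit (r : R) : exists2 p : nat, (0 < p)%N & r <= 1 *+ p.
Proof.
exists (Num.bound `|r|).
  by rewrite -(ltr0n R); apply: le_lt_trans (archi_boundP _).
by apply/ltW/(le_lt_trans (ler_norm r))/archi_boundP.
Qed.

HB.instance Definition _ := isUnitalLGroup.Build R real_strong_unit.
End real_lgroup.

Definition Ca (R : realType) (X : compactASpaceType) : Type := amap X R.

Section Ca.
Variables (R : realType) (X : compactASpaceType).
Implicit Types (a b : Ca R X).

HB.instance Definition _ := gen_eqMixin (Ca R X).
HB.instance Definition _ := gen_choiceMixin (Ca R X).

Let ac a : continuous (a : X -> R). Proof. exact: amap_continuous. Qed.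
Let az a x : (den (a x : R) %| zeta x)%N. Proof. exact: amap_zeta. Qed.

Definition Ca_cst (n : nat) : Ca R X :=
  @AMap X R (fun=> n%:R) (fun x => cvg_cst _) (fun x => den_nat R n (zeta x)).

Definition Ca_add a b : Ca R X :=
  @AMap X R (fun x => a x + b x) (fun x => cvgD (@ac a x) (@ac b x))
    (fun x => den_add (@az a x) (@az b x)).

Definition Ca_opp a : Ca R X :=
  @AMap X R (fun x => - a x) (fun x => cvgN (@ac a x))
    (fun x => den_opp (@az a x)).

Definition Ca_min a b : Ca R X :=
  @AMap X R (fun x => Num.min (a x) (b x))
    (fun x => continuous_min (@ac a x) (@ac b x))
    (fun x => den_min (@az a x) (@az b x)).

Definition Ca_max a b : Ca R X :=
  @AMap X R (fun x => Num.max (a x) (b x))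
    (fun x => continuous_max (@ac a x) (@ac b x))
    (fun x => den_max (@az a x) (@az b x)).

Definition Ca_le a b : bool := `[< forall x, a x <= b x :> R >].

Fact Ca_addA : associative Ca_add.
Proof. by move=> a b c; apply: amap_eq => x; exact: addrA. Qed.
Fact Ca_addC : commutative Ca_add.
Proof. by move=> a b; apply: amap_eq => x; exact: addrC. Qed.
Fact Ca_add0 : left_id (Ca_cst 0) Ca_add.
Proof. by move=> a; apply: amap_eq => x; exact: add0r. Qed.
Fact Ca_addN : left_inverse (Ca_cst 0) Ca_opp Ca_add.
Proof. by move=> a; apply: amap_eq => x; exact: addNr. Qed.

HB.instance Definition _ :=
  GRing.isZmodule.Build (Ca R X) Ca_addA Ca_addC Ca_add0 Ca_addN.

Fact Ca_le_refl : reflexive Ca_le.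
Proof. by move=> a; apply/asboolP. Qed.
Fact Ca_le_anti : antisymmetric Ca_le.
Proof.
move=> a b /andP[/asboolP ab /asboolP ba]; apply: amap_eq => x.
by apply/le_anti; rewrite ab ba.
Qed.
Fact Ca_le_trans : transitive Ca_le.
Proof.
move=> b a c /asboolP ab /asboolP bc; apply/asboolP => x.
exact: le_trans (ab x) (bc x).
Qed.

HB.instance Definition _ := Order.Le_isPOrder.Build ring_display (Ca R X)
  Ca_le_refl Ca_le_anti Ca_le_trans.

Fact Ca_le_min c a b : (c <= Ca_min a b) = (c <= a) && (c <= b).
Proof.
apply/asboolP/andP => [H|[/asboolP ca /asboolP cb] x]; last first.
  by rewrite /= le_min ca cb.
by split; apply/asboolP => x; have := H x; rewrite /= le_min => /andP[].
Qed.

Fact Ca_max_le c a b : (Ca_max a b <= c) = (a <= c) && (b <= c).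
Proof.
apply/asboolP/andP => [H|[/asboolP ca /asboolP cb] x]; last first.
  by rewrite /= ge_max ca cb.
by split; apply/asboolP => x; have := H x; rewrite /= ge_max => /andP[].
Qed.

Fact Ca_leD2l c a b : a <= b -> c + a <= c + b.
Proof. by move=> /asboolP ab; apply/asboolP => x; rewrite /= lerD2l. Qed.

HB.instance Definition _ :=
  isLGroup.Build (Ca R X) Ca_le_min Ca_max_le Ca_leD2l.

Fact Ca_mulrn n x : (Ca_cst 1 *+ n : Ca R X) x = n%:R.
Proof. by elim: n => [|n IHn] //; rewrite mulrS /= IHn nat1r. Qed.

Fact Ca_strong_unit a : exists2 p : nat, (0 < p)%N & a <= Ca_cst 1 *+ p.
Proof.
have : compact [set a x | x in [set: X]].
  apply: continuous_compact; last exact: compact_setT.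
  by apply: continuous_subspaceT => x; exact: (@ac a x).
move=> /compact_bounded[M [_ /(_ (M + 1))]]; rewrite ltrDl ltr01 => /(_ isT) aM.
have [p p0 Mp] := real_strong_unit (M + 1).
exists p => //; apply/asboolP => x; rewrite Ca_mulrn.
by apply: le_trans Mp; apply: le_trans (ler_norm _) _; apply: aM; exists x.
Qed.

HB.instance Definition _ := isUnitalLGroup.Build (Ca R X) Ca_strong_unit.
End Ca.

Definition Max (R : realType) (G : unitalLGroupType) : Type := ulhom G R.

Section Max.
Variables (R : realType) (G : unitalLGroupType).

Definition Max_subbase : set (set (Max R G)) :=
  [set [set x : Max R G | U (x g)] | g in [set: G] & U in @open R].

HB.instance Definition _ := gen_eqMixin (Max R G).
HB.instance Definition _ := gen_choiceMixin (Max R G).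
HB.instance Definition _ :=
  isSubBaseTopological.Build (Max R G) Max_subbase id.

Lemma Max_cvg (F : set_system (Max R G)) (h : Max R G) : Filter F ->
  (forall (g : G) (U : set R), open U -> U (h g) -> F [set x | U (x g)]) ->
  F --> h.
Proof.
move=> FF Fh A; rewrite nbhsE => -[B [oB Bh] BA]; apply: filterS BA _.
case: oB => D DS DB; move: Bh; rewrite -{}DB => -[V DV Vh].
apply: (@filterS _ F _ V); first by move=> x Vx; exists V.
move: DV => /DS[E ES VE]; rewrite -{}VE in Vh *.
apply: filter_bigI => W WE; have := Vh W WE.
by have /set_mem[g _ [U oU <-]] := ES _ WE; exact: Fh.
Qed.

Lemma Max_eval_continuous (g : G) : continuous (fun x : Max R G => x g : R).
Proof.
apply/continuousP => U oU.
exists [set [set x : Max R G | U (x g)]]; last exact: bigcup_set1.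
by move=> _ ->; apply: finI_from1; exists g => //; exists U.
Qed.

Lemma ulhom0 (x : Max R G) : x 0 = 0.
Proof. by apply: (addrI (x 0)); rewrite -ulhomD !addr0. Qed.

Lemma ulhomN (x : Max R G) : {morph x : g / - g}.
Proof. by move=> g; apply: (addrI (x g)); rewrite -ulhomD !subrr ulhom0. Qed.

Lemma ulhom_mulrn (x : Max R G) n : {morph x : g / g *+ n}.
Proof.
move=> g; elim: n => [|n IHn]; first by rewrite !mulr0n ulhom0.
by rewrite !mulrS ulhomD IHn.
Qed.

Lemma ulhom_le (x : Max R G) : {homo x : g g' / g <= g'}.
Proof.
move=> g g' gg'; have gE : lmeet g g' = g.
  apply/le_anti; rewrite le_lmeet lexx gg' !andbT.
  by have := lexx (lmeet g g'); rewrite le_lmeet => /andP[].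
rewrite -gE ulhomI; have := lexx (lmeet (x g) (x g')).
by rewrite le_lmeet => /andP[].
Qed.

Lemma Max_bounded (g : G) : exists M : R, forall x : Max R G, x g \in `[- M, M].
Proof.
have [p _ gp] := lunit_strong g; have [q _ gq] := lunit_strong (- g).
exists (p%:R + q%:R) => x; rewrite in_itv/=; apply/andP; split.
  rewrite lerNl -ulhomN; apply: le_trans (ulhom_le x gq) _.
  by rewrite ulhom_mulrn ulhom1 lerDr.
by apply: le_trans (ulhom_le x gp) _; rewrite ulhom_mulrn ulhom1 lerDl.
Qed.

Lemma Max_compact : compact [set: Max R G].
Proof.
rewrite compact_ultra => F FU _.
have /choice[h hF] : forall g : G, exists r : R,
    (fun x : Max R G => x g : R) @ F --> r.
  move=> g; have [M gM] := Max_bounded g.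
  have /(_ ((fun x : Max R G => x g : R) @ F)) := @segment_compact R (- M) M.
  have PF : ProperFilter ((fun x : Max R G => x g : R) @ F).
    exact: fmap_proper_filter.
  move=> /(_ PF); case; first by apply: (@filterE _ F) => x; exact: gM.
  move=> r [_ rF]; exists r => U Ur; rewrite /= /nbhs/=.
  have [//|nU] := in_ultra_setVsetC ((fun x : Max R G => x g : R) @^-1` U) FU.
  have [s [/= nUs Us]] : ~` U `&` U !=set0 by exact: rF.
  by [].
have hcst (f : Max R G -> R) r s : (forall x, f x = s) -> f @ F --> r -> r = s.
  move=> fs fr; apply: (cvg_unique _ fr) => //.
  by rewrite (_ : f = cst s); [exact: cvg_cst|exact/funext].
have hD : {morph h : a b / a + b}.
  move=> a b; apply: (cvg_unique _ (hF (a + b))) => //.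
  rewrite (_ : (fun _ => _) = (fun x : Max R G => x a + x b : R)).
    exact: cvgD (hF a) (hF b).
  by apply/funext => x; rewrite ulhomD.
have hI : {morph h : a b / lmeet a b}.
  move=> a b; apply: (cvg_unique _ (hF (lmeet a b))) => //.
  rewrite (_ : (fun _ => _) = (fun x : Max R G => Num.min (x a) (x b) : R)).
    by apply: continuous2_cvg (hF a) (hF b); exact: (@min_continuous _ R (h a, h b)).
  by apply/funext => x; rewrite ulhomI.
have hU : {morph h : a b / ljoin a b}.
  move=> a b; apply: (cvg_unique _ (hF (ljoin a b))) => //.
  rewrite (_ : (fun _ => _) = (fun x : Max R G => Num.max (x a) (x b) : R)).
    by apply: continuous2_cvg (hF a) (hF b); exact: (@max_continuous _ R (h a, h b)).
  by apply/funext => x; rewrite ulhomU.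
have h1 : h lunit = lunit by apply: hcst (hF _) => x; exact: ulhom1.
exists (@ULHom G R h hD hI hU h1); split => //.
apply: Max_cvg => g U oU Uh; apply: (hF g); exact: open_nbhs_nbhs.
Qed.

Definition Max_zeta (x : Max R G) : natdvd :=
  lcm_set [set den (x g : R) | g in [set: G]].

Lemma Max_zeta_dvd (x : Max R G) (n : nat) :
  (Max_zeta x %| n)%N <-> forall g : G, (den (x g : R) %| n)%N.
Proof.
by rewrite lcm_set_dvd; split => [H g|H _ [g _ <-] //]; apply: H; exists g.
Qed.

Lemma Max_zeta_continuous : continuous Max_zeta.
Proof.
apply: natdvd_continuous => n.
rewrite (_ : [set _ | _] =
    \bigcap_(g in [set: G]) [set x : Max R G | (den (x g : R) %| n)%N]).
  apply: closed_bigI => g _.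
  rewrite (_ : [set _ | _] = (fun x : Max R G => x g : R) @^-1`
      [set r : R | (den r %| n)%N]) //.
  apply: preimage_closed (@den_closed R n) => x _.
  exact: Max_eval_continuous.
apply/seteqP; split => x /=; rewrite Max_zeta_dvd; first by move=> H g _; exact: H.
by move=> H g; exact: H.
Qed.

HB.instance Definition _ := isASpace.Build (Max R G) Max_zeta_continuous.
HB.instance Definition _ := isCompact.Build (Max R G) Max_compact.
End Max.

Section Max_fmap.
Variables (R : realType) (G H : unitalLGroupType) (f : ulhom G H).

Definition Max_precomp (x : Max R H) : Max R G := ulhom_comp x f.

Fact Max_precomp_continuous : continuous Max_precomp.
Proof.
move=> x; apply: Max_cvg => [|g U oU Ux]; first by apply: fmap_filter; exact: nbhs_filter.
by apply: (@Max_eval_continuous R H (f g) x); exact: open_nbhs_nbhs.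
Qed.

Fact Max_precomp_zeta x : (zeta (Max_precomp x) %| zeta x)%N.
Proof.
apply/Max_zeta_dvd => g /=.
by have /Max_zeta_dvd := dvdnn (Max_zeta x); exact.
Qed.

Definition Max_fmap : amap (Max R H) (Max R G) :=
  AMap Max_precomp_continuous Max_precomp_zeta.
End Max_fmap.

Definition Max_functor (R : realType) : cofunctor ulgroup_cat compact_aspace_cat.
Proof.
refine (@Cofunctor ulgroup_cat compact_aspace_cat (Max R) (@Max_fmap R) _ _);
  by move=> *; apply: amap_eq => x; exact: ulhom_eq.
Defined.

Section Ca_fmap.
Variables (R : realType) (X Y : compactASpaceType) (f : amap X Y).

Definition Ca_precomp (a : Ca R Y) : Ca R X := amap_comp a f.

Fact Ca_precompD : {morph Ca_precomp : a b / a + b}.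
Proof. by move=> a b; exact: amap_eq. Qed.

Fact Ca_precompI : {morph Ca_precomp : a b / lmeet a b}.
Proof. by move=> a b; exact: amap_eq. Qed.

Fact Ca_precompU : {morph Ca_precomp : a b / ljoin a b}.
Proof. by move=> a b; exact: amap_eq. Qed.

Fact Ca_precomp1 : Ca_precomp lunit = lunit.
Proof. exact: amap_eq. Qed.

Definition Ca_fmap : ulhom (Ca R Y) (Ca R X) :=
  ULHom Ca_precompD Ca_precompI Ca_precompU Ca_precomp1.
End Ca_fmap.

Definition Ca_functor (R : realType) : cofunctor compact_aspace_cat ulgroup_cat.
Proof.
refine (@Cofunctor compact_aspace_cat ulgroup_cat (Ca R) (@Ca_fmap R) _ _);
  by move=> *; apply: ulhom_eq => a; exact: amap_eq.
Defined.

(* Main.v *)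
Require Import Defs.
From mathcomp Require Import all_boot all_order all_algebra.
From mathcomp Require Import all_classical all_reals all_analysis.

(** The adjunction is the one induced by the dualizing object [R], which is both
    a unital l-group and an a-space: an element of [X] paired with an a-map
    [X -> R], or an element of [G] paired with a homomorphism [G -> R], gives a
    real number, and the two units are the two curryings of this evaluation.
    Evaluation at [x] is a homomorphism because the operations of [Ca R X] are
    pointwise, and [g |-> ev_g] is one because every [h] in [Max R G] is:
    [ev_(g + g') h = h (g + g') = h g + h g'], and likewise for the lattice
    operations and the unit.

    The topology and the denominators of [Max R G] are the least demanding ones
    for which every [ev_g] is an a-map: [Max R G] has the initial topology, and
    the denominator of [h] is the least common multiple of the [den (h g)].
    Hence [ev_g] is an a-map, and a map into [Max R G] is an a-map as soon as
    its composites with all [ev_g] are (lemmas [Max_cvg] and [Max_zeta_dvd]).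
    For [x |-> ev_x] the composite with [ev_a] is the a-map [a] itself.

    Naturality and the triangle identities equate morphisms that, once all
    evaluations are carried out, take equal values by computation. *)

Set Implicit Arguments.
Unset Strict Implicit.
Unset Printing Implicit Defensive.

Import numFieldNormedType.Exports.
Local Open Scope ring_scope.

Section point_evaluation.
Variables (R : realType) (X : compactASpaceType).

Definition ev_point (x : X) : Max R (Ca R X) :=
  @ULHom (Ca R X) R (fun a => a x) (fun _ _ => erefl) (fun _ _ => erefl)
    (fun _ _ => erefl) erefl.

Fact ev_point_continuous : continuous ev_point.
Proof.
move=> x; apply: Max_cvg => a U oU Uax.
have a_cont : continuous (a : X -> R) by exact: amap_continuous.
by apply: (a_cont x); exact: open_nbhs_nbhs.
Qed.

Fact ev_point_zeta x : (zeta (ev_point x) %| zeta x)%N.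
Proof. by apply/Max_zeta_dvd => a; exact: (amap_zeta a x). Qed.

Definition Max_unit : amap X (Max R (Ca R X)) :=
  AMap ev_point_continuous ev_point_zeta.

End point_evaluation.

Section element_evaluation.
Variables (R : realType) (G : unitalLGroupType).

Fact ev_elt_zeta (g : G) (h : Max R G) :
  (zeta (h g : R) %| zeta h)%N.
Proof. by have /Max_zeta_dvd := dvdnn (Max_zeta h); exact. Qed.

Definition ev_elt (g : G) : Ca R (Max R G) :=
  @AMap (Max R G) R (fun h => h g) (@Max_eval_continuous R G g)
    (ev_elt_zeta g).

Fact ev_eltD : {morph ev_elt : g g' / g + g'}.
Proof. by move=> g g'; apply: amap_eq => h; exact: ulhomD. Qed.

Fact ev_eltI : {morph ev_elt : g g' / lmeet g g'}.
Proof. by move=> g g'; apply: amap_eq => h; exact: ulhomI. Qed.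

Fact ev_eltU : {morph ev_elt : g g' / ljoin g g'}.
Proof. by move=> g g'; apply: amap_eq => h; exact: ulhomU. Qed.

Fact ev_elt1 : ev_elt lunit = lunit.
Proof. by apply: amap_eq => h; exact: ulhom1. Qed.

Definition Ca_unit : ulhom G (Ca R (Max R G)) :=
  ULHom ev_eltD ev_eltI ev_eltU ev_elt1.

End element_evaluation.

Lemma Max_Ca_adjunction (R : realType) :
  contra_adjunction (F := Max_functor R) (H := Ca_functor R)
    (@Max_unit R) (@Ca_unit R).
Proof.
split.
- by move=> X Y f; apply: amap_eq => x; exact: ulhom_eq.
- by move=> G H f; apply: ulhom_eq => g; exact: amap_eq.
- by move=> G; apply: amap_eq => h; exact: ulhom_eq.
- by move=> X; apply: ulhom_eq => a; exact: amap_eq.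
Qed.

Theorem proposition2p9 (R : realType) :
  exists (eta : forall X : compactASpaceType, amap X (Max R (Ca R X)))
    (eps : forall G : unitalLGroupType, ulhom G (Ca R (Max R G))),
  [/\ forall (X : compactASpaceType) (x : X) (a : Ca R X), eta X x a = a x,
      forall (G : unitalLGroupType) (g : G) (h : Max R G), eps G g h = h g
    & contra_adjunction (F := Max_functor R) (H := Ca_functor R) eta eps].
Proof.
by exists (@Max_unit R), (@Ca_unit R); split=> //; exact: Max_Ca_adjunction.
Qed.
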